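(* Let $\lambda>0$, $\sigma>0$, and let $X\sim\mathcal N(0,\sigma^2)$. For $y>x^2$ let $$g_{ML}(x,y)=\Phi\left(\frac{\lambda-x}{\sqrt{y-x^2}}\right)-\Phi\left(\frac{-\lambda-x}{\sqrt{y-x^2}}\right),$$ where $\Phi$ is the standard Gaussian distribution function, so that the maximum likelihood estimator of $\mathbb{P}[-\lambda\le X\le\lambda]$ based on an iid sample $X_1,\dots,X_n$ of $X$ is $g_{ML}\left(\frac1n\sum X_i,\frac1n\sum X_i^2\right)$. Then the quantity $A$ and the acceleration constant $a$ of the bootstrap bias-corrected and accelerated technique associated with this estimator (both defined in the context) are $$A=-2\sqrt2,\qquad a=-\frac{\sqrt2}{3\sqrt n}.$$ In particular they depend neither on $\sigma$ nor on $\lambda$.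
   Context: Let $\mathbf{X}=(X,X^2,X^3,X^4)$, $\boldsymbol\mu=\mathbb{E}\mathbf{X}=(0,\sigma^2,0,3\sigma^4)$, and for $\mathbf{x}=(x_1,\dots,x_4)$ define $h_{ML}(\mathbf{x})\ge0$ by $$h_{ML}^2(\mathbf{x})=\sum_{i=1}^2\sum_{j=1}^2\partial_ig_{ML}(x_1,x_2)\,\partial_jg_{ML}(x_1,x_2)\,(x_{i+j}-x_ix_j).$$ Let $A_{ML,s}(\mathbf{x})=\big(g_{ML}(x_1,x_2)-g_{ML}(0,\sigma^2)\big)/h_{ML}(\mathbf{x})$, $a_i=\partial_iA_{ML,s}(\boldsymbol\mu)$, and $\mu_{i_1\ldots i_j}=\mathbb{E}\big[(X^{i_1}-\mathbb{E}X^{i_1})\cdots(X^{i_j}-\mathbb{E}X^{i_j})\big]$. Then $$A=\sum_{i,j,k=1}^4a_ia_ja_k\mu_{ijk},\qquad a=\frac{A}{6\,\tau^3\sqrt n},\quad\text{where }\tau>0,\ \tau^2=\sum_{i,j=1}^4a_ia_j\mu_{ij}$$ (for this normalized function $\tau=1$). *)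

(* Defs.v *)
From HB Require Import structures.
From mathcomp Require Import all_boot all_order all_algebra.
From mathcomp Require Import all_classical all_reals all_analysis.
Set Implicit Arguments.
Unset Strict Implicit.
Unset Printing Implicit Defensive.
Import Order.TTheory GRing.Theory Num.Theory.
Import numFieldNormedType.Exports.
Local Open Scope classical_set_scope.
Local Open Scope ring_scope.

(* Coordinates and partial derivatives are numbered from 1, as in
   x = (x_1, ..., x_d.+1); only indices 1 <= k <= d.+1 are meaningful. *)
Definition crd {R : realType} {d : nat} (x : 'rV[R]_d.+1) (k : nat) : R :=
  x 0 (inord k.-1).

Definition partial {R : realType} {d : nat} (k : nat) (f : 'rV[R]_d.+1 -> R)
    (x : 'rV[R]_d.+1) : R :=
  'D_(delta_mx 0 (inord k.-1)) f x.

Definition row2 {R : realType} (x y : R) : 'rV[R]_2 :=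
  \row_(i < 2) (if i == 0 then x else y).

Definition Phi {R : realType} (z : R) : R :=
  fine (normal_prob 0 1 `]-oo, z]).

(* The formula is meant for y > x ^ 2; elsewhere the value is irrelevant. *)
Definition g_ML {R : realType} (lam x y : R) : R :=
  Phi ((lam - x) / Num.sqrt (y - x ^+ 2)) -
  Phi ((- lam - x) / Num.sqrt (y - x ^+ 2)).

(* Maximum likelihood in the Gaussian model {N(m, s^2) : m real, s > 0}.  The
   parameter of normal_pdf and normal_prob is the standard deviation s. *)
Definition likelihood {R : realType} {n : nat} (x : 'I_n -> R) (m s : R) : R :=
  \prod_(i < n) normal_pdf m s (x i).

Definition is_gaussian_MLE {R : realType} {n : nat} (x : 'I_n -> R) (m s : R) :=
  0 < s /\
  forall m' s' : R, 0 < s' -> likelihood x m' s' <= likelihood x m s.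

(* p is a maximum likelihood estimate of P[-lam <= X <= lam] from the data x *)
Definition is_interval_MLE {R : realType} {n : nat} (lam : R) (x : 'I_n -> R)
    (p : R) :=
  exists m s : R,
    is_gaussian_MLE x m s /\ p = fine (normal_prob m s `[- lam, lam]).

Definition sample_moment {R : realType} {n : nat} (x : 'I_n -> R) (k : nat) : R :=
  n%:R^-1 * \sum_(i < n) x i ^+ k.

Definition partial_g_ML {R : realType} (lam : R) (i : nat) (x y : R) : R :=
  partial i (fun v : 'rV[R]_2 => g_ML lam (crd v 1) (crd v 2)) (row2 x y).

Definition h_ML {R : realType} (lam : R) (x : 'rV[R]_4) : R :=
  Num.sqrt (\sum_(1 <= i < 3) \sum_(1 <= j < 3)
    partial_g_ML lam i (crd x 1) (crd x 2) *
    partial_g_ML lam j (crd x 1) (crd x 2) *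
    (crd x (i + j) - crd x i * crd x j)).

Definition A_MLs {R : realType} (lam sigma : R) (x : 'rV[R]_4) : R :=
  (g_ML lam (crd x 1) (crd x 2) - g_ML lam 0 (sigma ^+ 2)) / h_ML lam x.

Section Moments.
Context {d : measure_display} {T : measurableType d} {R : realType}.
Variables (P : probability T R) (X : {RV P >-> R}).

(* equality of laws, required on measurable sets only *)
Definition has_normal_law (m s : R) :=
  forall B : set R, measurable B -> distribution P X B = normal_prob m s B.

Definition moment (k : nat) : R := fine 'E_P[fun w => X w ^+ k].

(* mu_(i_1 ... i_j) for s = [:: i_1; ...; i_j] *)
Definition cmoment (s : seq nat) : R :=
  fine 'E_P[fun w => \prod_(i <- s) (X w ^+ i - moment i)].

Definition mean_vec : 'rV[R]_4 := \row_(k < 4) moment k.+1.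

Variables lam sigma : R.

Definition coef_a (i : nat) : R := partial i (A_MLs lam sigma) mean_vec.

Definition BCa_A : R :=
  \sum_(1 <= i < 5) \sum_(1 <= j < 5) \sum_(1 <= k < 5)
    coef_a i * coef_a j * coef_a k * cmoment [:: i; j; k].

Definition BCa_tau : R :=
  Num.sqrt (\sum_(1 <= i < 5) \sum_(1 <= j < 5)
    coef_a i * coef_a j * cmoment [:: i; j]).

Definition BCa_acceleration (n : nat) : R :=
  BCa_A / (6 * BCa_tau ^+ 3 * Num.sqrt n%:R).

End Moments.

(* Main.v *)
(* The Gaussian likelihood of a sample with mean m1 and variance v > 0 is the
   n-th power of a function of (m, s) whose only maximum is (m1, sqrt v), and
   N(m, s^2) gives [-lam, lam] the mass
   Phi ((lam - m) / s) - Phi ((- lam - m) / s).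

   For the acceleration constant, the numerator of A_ML,s vanishes at the mean
   vector, so its gradient there is that of g_ML divided by h_ML; no derivative
   of h_ML is needed, only its continuity.  By the symmetry of the normal
   density the x-derivative of g_ML vanishes at (0, sigma^2), and h_ML equals
   |d_2 g_ML| sigma^2 sqrt 2, since E X^4 - (E X^2)^2 = 2 sigma^4.  Hence
   a_2 = - 1 / (sigma^2 sqrt 2) is the only nonzero coefficient, and A and
   tau^2 reduce to a_2^3 mu_222 and a_2^2 mu_22, where mu_222 = 8 sigma^6 and
   mu_22 = 2 sigma^4. *)
Require Import Defs.
From HB Require Import structures.
From mathcomp Require Import all_boot all_order all_algebra.
From mathcomp Require Import all_classical all_reals all_analysis.
From mathcomp Require Import measurable_realfun ring lra.
Import Order.TTheory GRing.Theory Num.Theory.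
Import numFieldNormedType.Exports.
Local Open Scope classical_set_scope.
Local Open Scope ring_scope.

(** * The normal distribution function *)

Lemma normal_pdf_even (R : realType) (s x : R) : s != 0 ->
  normal_pdf 0 s (- x) = normal_pdf 0 s x.
Proof. by move=> s0; rewrite !normal_pdfE// /normal_fun !subr0 sqrrN. Qed.

Lemma is_derive_fine_normal_prob (R : realType) (m s z : R) : s != 0 ->
  is_derive z 1 (fun t => fine (normal_prob m s `]-oo, t])) (normal_pdf m s z).
Proof.
move=> s0.
(* Any point to the right of [z] serves as upper end for the fundamental theorem; [z + 1] is one. *)
have [||||dF F'] := @continuous_FTC1 R (normal_pdf m s) -oo%O z (z + 1).
- by rewrite ltrDl.
- by apply: integrableS (integrable_normal_pdf m s).
- exact: ltNyr.
- exact: continuous_normal_pdf.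
by rewrite derive1E in F'; exact: (DeriveDef dF F').
Qed.

Lemma is_derive_Phi (R : realType) (z : R) : is_derive z 1 Phi (normal_pdf 0 1 z).
Proof. by apply: is_derive_fine_normal_prob; rewrite oner_neq0. Qed.

Lemma normal_peakE (R : realType) (s : R) : 0 < s ->
  normal_peak s = s^-1 * normal_peak 1.
Proof.
move=> s0; rewrite /normal_peak expr1n mul1r -invfM; congr _^-1.
by rewrite -mulrnAr sqrtrM ?sqr_ge0// sqrtr_sqr gtr0_norm.
Qed.

(** The left-hand side is what the chain rule yields when [Phi ((z - m) / s)] is differentiated in
    [z]. *)
Lemma normal_pdf_standardize (R : realType) (m s z : R) : 0 < s ->
  normal_pdf 0 1 ((z - m) / s) * s^-1 = normal_pdf m s z.
Proof.
move=> s0; have sN0 : s != 0 by rewrite gt_eqF.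
rewrite (normal_pdfE _ (oner_neq0 R)) (normal_pdfE _ sN0) (normal_peakE _ s s0).
rewrite /normal_fun subr0 mulrAC [normal_peak 1 * _]mulrC; congr (_ * expR _).
by field.
Qed.

(** The map [t -> Phi ((t - m) / s)] is an antiderivative of the density on the whole line, so the
    fundamental theorem on [[a, b]] gives the mass. *)
Lemma normal_prob_itv (R : realType) (m s a b : R) : 0 < s -> a < b ->
  fine (normal_prob m s `[a, b]) = Phi ((b - m) / s) - Phi ((a - m) / s).
Proof.
move=> s0 ab; have sN0 : s != 0 by rewrite gt_eqF.
have dF (x : R) : is_derive x 1 (fun t => Phi ((t - m) / s)) (normal_pdf m s x).
  rewrite -normal_pdf_standardize//.
  have dl : is_derive x 1 (fun t => (t - m) / s) s^-1.
    by apply: is_derive_eq; rewrite /= subr0 ?scaler0 ?add0r scaler1.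
  have := @is_derive1_comp _ Phi (fun t => (t - m) / s) x _ _ (is_derive_Phi _ _) dl.
  by rewrite /GRing.scale/=.
have cF (x : R) : {for x, continuous (fun t => Phi ((t - m) / s))}.
  by apply: differentiable_continuous; apply/derivable1_diffP; case: (dF x).
rewrite /normal_prob (@continuous_FTC2 _ _ (fun t => Phi ((t - m) / s)))//.
- by apply: continuous_subspaceT; exact: continuous_normal_pdf.
- split; first by move=> x _; case: (dF x).
  + exact/cvg_at_right_filter/cF.
  + exact/cvg_at_left_filter/cF.
- by move=> x _; rewrite derive1E; case: (dF x).
Qed.

(** * Maximum likelihood *)

(** Decomposition into variance and squared bias: the sample enters the likelihood only through its
    first two moments. *)
Lemma sum_sqr_sub (R : realType) (n : nat) (x : 'I_n -> R) (m : R) : (0 < n)%N ->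
  \sum_(i < n) (x i - m) ^+ 2 =
  n%:R * (sample_moment x 2 - sample_moment x 1 ^+ 2
          + (sample_moment x 1 - m) ^+ 2).
Proof.
move=> n0; have nN0 : n%:R != 0 :> R by rewrite pnatr_eq0 -lt0n.
under eq_bigr do rewrite sqrrB.
rewrite big_split/= sumrB sumr_const card_ord sumrMnl -mulr_suml.
have -> : sample_moment x 1 = n%:R^-1 * \sum_(i < n) x i by [].
rewrite /sample_moment.
set S2 := \sum_(i < n) x i ^+ 2; set S1 := \sum_(i < n) x i.
rewrite -[m ^+ 2 *+ n]mulr_natl -[S1 * m *+ 2]mulr_natl.
by field.
Qed.

(** In this form, comparing two likelihoods amounts to comparing the nonnegative bases of two [n]-th
    powers. *)
Lemma likelihoodE (R : realType) (n : nat) (x : 'I_n -> R) (m s : R) :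
  (0 < n)%N -> 0 < s ->
  likelihood x m s =
  (normal_peak s * expR (- (sample_moment x 2 - sample_moment x 1 ^+ 2
     + (sample_moment x 1 - m) ^+ 2) / (s ^+ 2 *+ 2))) ^+ n.
Proof.
move=> n0 s0; rewrite /likelihood normal_pdfE ?gt_eqF//.
rewrite big_split/= prodr_const card_ord exprMn; congr (_ * _).
rewrite -expR_sum -expRM_natl -!mulr_suml sumrN sum_sqr_sub//.
by congr expR; rewrite mulrA mulrN.
Qed.

(* With [w = v / s], the bound [w <= expR (w - 1)] leaves the exponent
   [- (w - 1)^2 / 2 - d^2 / (2 s^2)]. *)
Lemma gaussian_profile_max (R : realType) (v s d : R) : 0 < v -> 0 < s ->
  let f s d := normal_peak s * expR (- (v ^+ 2 + d ^+ 2) / (s ^+ 2 *+ 2)) in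
  f s d <= f v 0 /\ (f v 0 <= f s d -> s = v /\ d = 0).
Proof.
move=> v0 s0 f; pose w := v / s.
have vN0 : v != 0 by rewrite gt_eqF.
have sN0 : s != 0 by rewrite gt_eqF.
pose e := w - 1 + ((1 - w ^+ 2) / 2 - (d / s) ^+ 2 / 2).
have eE : e = - ((w - 1) ^+ 2 + (d / s) ^+ 2) / 2 by rewrite /e; field.
have fv0 : 0 < f v 0 by rewrite mulr_gt0 ?expR_gt0// normal_peak_gt0.
have w0 : 0 < w by rewrite divr_gt0.
have fE : f s d = f v 0 * (w * expR ((1 - w ^+ 2) / 2 - (d / s) ^+ 2 / 2)).
  rewrite /f (normal_peakE _ s s0) (normal_peakE _ v v0).
  have -> : - (v ^+ 2 + d ^+ 2) / (s ^+ 2 *+ 2) =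
      - (v ^+ 2 + 0 ^+ 2) / (v ^+ 2 *+ 2) + ((1 - w ^+ 2) / 2 - (d / s) ^+ 2 / 2).
    by rewrite /w; field; rewrite sN0 vN0.
  by rewrite expRD /w; field; rewrite sN0 vN0.
have fle : f s d <= f v 0 * expR e.
  rewrite fE /e (expRD (w - 1)); rewrite (ler_pM2l fv0) ler_pM2r ?expR_gt0//.
  by apply: le_trans (expR_ge1Dx _); rewrite addrC subrK.
have e0 : e <= 0.
  by rewrite eE mulNr oppr_le0 divr_ge0// addr_ge0 ?sqr_ge0.
split.
  by rewrite (le_trans fle)// ger_pMr// -expR0 ler_expR.
(* Equality case: the two bounds give [0 <= e], while [e] is minus half a sum of two squares, so
   both squares vanish. *)
move=> ffe; have := le_trans ffe fle.
rewrite ler_pMr// -expR0 ler_expR => e0'.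
have : (w - 1) ^+ 2 + (d / s) ^+ 2 = 0.
  by apply/eqP; rewrite eq_le addr_ge0 ?sqr_ge0// andbT; move: e0'; rewrite eE; lra.
move/eqP; rewrite paddr_eq0 ?sqr_ge0// !sqrf_eq0 subr_eq0 => /andP[/eqP w1].
rewrite mulf_eq0 invr_eq0 (negbTE sN0) orbF => /eqP ->; split=> //.
by rewrite -[RHS](divfK sN0) -/w w1 mul1r.
Qed.

Lemma gaussian_MLE_iff (R : realType) (n : nat) (x : 'I_n -> R) (m s : R) :
  (0 < n)%N -> sample_moment x 1 ^+ 2 < sample_moment x 2 ->
  is_gaussian_MLE x m s <->
  m = sample_moment x 1 /\ s = Num.sqrt (sample_moment x 2 - sample_moment x 1 ^+ 2).
Proof.
move=> n0; rewrite -subr_gt0 => vpos.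
set v := Num.sqrt _; have v0 : 0 < v by rewrite sqrtr_gt0.
have v2 : sample_moment x 2 - sample_moment x 1 ^+ 2 = v ^+ 2.
  by rewrite sqr_sqrtr// ltW.
have LE m' s' : 0 < s' -> likelihood x m' s' = (normal_peak s' * expR (- (v ^+ 2
     + (sample_moment x 1 - m') ^+ 2) / (s' ^+ 2 *+ 2))) ^+ n.
  by move=> s'0; rewrite likelihoodE// v2.
have base0 m' s' : normal_peak s' * expR (- (v ^+ 2
     + (sample_moment x 1 - m') ^+ 2) / (s' ^+ 2 *+ 2)) \is Num.nneg.
  by rewrite nnegrE mulr_ge0 ?normal_peak_ge0 ?expR_ge0.
split=> [[s0 smax]|[-> ->]].
  (* Comparison with the single competitor [(sample_moment x 1, v)] already forces the equality case
     of [gaussian_profile_max]. *)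
  have := smax (sample_moment x 1) v v0.
  rewrite !LE// ler_pXn2r// subrr => H.
  have [_ /(_ H)[-> /eqP]] :=
    @gaussian_profile_max _ v s (sample_moment x 1 - m) v0 s0.
  by rewrite subr_eq0 => /eqP <-.
split=> // m' s' s'0; rewrite !LE// ler_pXn2r// subrr.
by have [] := @gaussian_profile_max _ v s' (sample_moment x 1 - m') v0 s'0.
Qed.

Lemma interval_MLE_iff (R : realType) (lam : R) (n : nat) (x : 'I_n -> R) (p : R) :
  0 < lam -> (0 < n)%N -> sample_moment x 1 ^+ 2 < sample_moment x 2 ->
  is_interval_MLE lam x p <->
  p = g_ML lam (sample_moment x 1) (sample_moment x 2).
Proof.
move=> lam0 n0 mx.
have gE : fine (normal_prob (sample_moment x 1)
    (Num.sqrt (sample_moment x 2 - sample_moment x 1 ^+ 2)) `[- lam, lam]) =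
    g_ML lam (sample_moment x 1) (sample_moment x 2).
  by rewrite normal_prob_itv ?sqrtr_gt0 ?subr_gt0//; lra.
split=> [[m [s [+ ->]]]|->].
  by move=> /(gaussian_MLE_iff _ _ _ _ _ n0 mx)[-> ->].
exists (sample_moment x 1); eexists; split; last exact: esym gE.
exact/gaussian_MLE_iff.
Qed.

(** * Normal moments *)

Lemma is_derive_normal_pdf (R : realType) (s x : R) : s != 0 ->
  is_derive x 1 (normal_pdf 0 s) (- (x / s ^+ 2) * normal_pdf 0 s x).
Proof.
move=> s0; rewrite normal_pdfE// /normal_fun.
have ha : is_derive x 1 (fun t : R => - (t - 0) ^+ 2 / (s ^+ 2 *+ 2))
    (- (x / s ^+ 2)).
  rewrite (_ : (fun t => _) = (fun t : R => (- (s ^+ 2 *+ 2)^-1) * t ^+ 2)).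
    by apply: is_derive_eq; rewrite /GRing.scale/=; field.
  by apply/funext => t; rewrite subr0 mulrC mulrN mulNr.
have H := @is_deriveZ _ _ _ _ (normal_peak s) x 1 _
  (@is_derive1_comp _ expR _ x _ _ (is_derive_expR _) ha).
apply: (is_derive_eq H); rewrite /GRing.scale/=; ring.
Qed.

(** With [y = x ^ 2 / (2 s ^ 2)], the bound [y ^ (m+1) / (m+1)! <= expR y] makes the product at most
    a constant times [x ^ -(m+2)], hence at most [C / x] once [x >= 1]. *)
Lemma cvg_expr_normal_pdf (R : realType) (s : R) (m : nat) : s != 0 ->
  x ^+ m * normal_pdf 0 s x @[x --> +oo] --> (0 : R).
Proof.
move=> s0; rewrite normal_pdfE// /normal_fun.
pose C := normal_peak s * (m.+1`!%:R * (s ^+ 2 *+ 2) ^+ m.+1).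
have s2 : 0 < s ^+ 2 *+ 2 by rewrite pmulrn_lgt0// exprn_even_gt0.
apply: (@squeeze_cvgr _ _ _ _ (fun=> 0) (fun x => C * x^-1)).
- near=> x; have x1 : 1 <= x by near: x; exact: nbhs_pinfty_ge.
  have x0 : 0 < x by exact: lt_le_trans x1.
  rewrite mulr_ge0 ?exprn_ge0 ?mulr_ge0 ?normal_peak_ge0 ?expR_ge0 ?(ltW x0)//=.
  rewrite mulrCA /C -!mulrA ler_wpM2l ?normal_peak_ge0//.
  rewrite subr0 mulNr expRN.
  set y := x ^+ 2 / _; have y0 : 0 < y by rewrite divr_gt0// exprn_gt0.
  have ey : y ^+ m.+1 / m.+1`!%:R <= expR y.
    by apply: le_trans (expR_ge1Dxn m (ltW y0)); rewrite lerDr.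
  have yf : 0 < y ^+ m.+1 / m.+1`!%:R by rewrite divr_gt0 ?exprn_gt0// ltr0n fact_gt0.
  apply: (@le_trans _ _ (x ^+ m * (y ^+ m.+1 / m.+1`!%:R)^-1)).
    by rewrite ler_wpM2l ?exprn_ge0 ?(ltW x0)// lef_pV2// posrE expR_gt0.
  have -> : x ^+ m * (y ^+ m.+1 / m.+1`!%:R)^-1 =
      m.+1`!%:R * ((s ^+ 2 *+ 2) ^+ m.+1 * (x ^+ m.+2)^-1).
    rewrite /y expr_div_n -exprM mul2n -addnn addSnnS exprD; field.
    by rewrite !expf_neq0 ?(gt_eqF x0) ?(gt_eqF s2)//= pnatr_eq0 -lt0n fact_gt0.
  rewrite !ler_wpM2l ?exprn_ge0 ?(ltW s2)// lef_pV2 ?posrE ?exprn_gt0//.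
  by rewrite -[X in X <= _]expr1 ler_weXn2l.
- exact: cvg_cst.
- rewrite -[X in _ --> X](mulr0 C); apply: cvgMr.
  by apply/gtr0_cvgV0; [near=> x; near: x; exact: nbhs_pinfty_gt|exact: cvg_id].
Unshelve. all: by end_near. Qed.

Lemma cvg_normal_cdf (R : realType) (m s : R) :
  fine (normal_prob m s `]-oo, x]) @[x --> +oo] --> (1 : R).
Proof.
(* The law is seen as the distribution of the identity variable, so that the limit of a distribution
   function at infinity applies. *)
pose mid := isMeasurableFun.Build _ _ (measurableTypeR R) R idfun
  (@measurable_id _ _ setT).
pose Y : {mfun measurableTypeR R >-> R} :=
  HB.pack (idfun : measurableTypeR R -> R) mid.
exact: fine_cvg (@cvg_cdfy1 _ _ R (normal_prob m s) Y).
Qed.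

(* Integrating [x ^ (2k+2) p] by parts gives
   [F_(k+1) = (2k+1) s^2 F_k - s^2 x^(2k+1) p], starting from the
   distribution function [F_0]. *)
Lemma normal_moment_primitive (R : realType) (s : R) (k : nat) : 0 < s ->
  exists F : R -> R,
  let F0 t := fine (normal_prob 0 s `]-oo, t]) in
  let c := (\prod_(i < k) (i.*2.+1)%:R) * s ^+ k.*2 in
  [/\ forall x : R, is_derive x 1 F (x ^+ k.*2 * normal_pdf 0 s x),
      F x @[x --> +oo] --> c & F 0 = c * F0 0].
Proof.
move=> s0; have sN0 : s != 0 by rewrite gt_eqF.
elim: k => [|k [F /= [dF Fl F0]]].
  exists (fun t => fine (normal_prob 0 s `]-oo, t])); split.
  - by move=> x; rewrite expr0 mul1r; exact: is_derive_fine_normal_prob.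
  - rewrite big_ord0 mul1r expr0.
    exact: cvg_normal_cdf.
  - by rewrite big_ord0 !mul1r.
exists (fun x => (k.*2.+1%:R * s ^+ 2) * F x
  - s ^+ 2 * (x ^+ k.*2.+1 * normal_pdf 0 s x)).
split.
- move=> x; have hp := is_derive_normal_pdf _ _ x sN0.
  have hX : is_derive x 1 (fun t : R => t ^+ k.*2.+1) (k.*2.+1%:R * x ^+ k.*2).
    apply: DeriveDef; first exact: exprn_derivable.
    by rewrite exp_derive [LHS]mulr1.
  have hM := is_deriveM hX hp.
  have H := is_deriveB (is_deriveZ (k.*2.+1%:R * s ^+ 2) (dF x))
    (is_deriveZ (s ^+ 2) hM).
  apply: (is_derive_eq H); rewrite /GRing.scale/=.
  by rewrite doubleS (exprS x k.*2.+1) (exprS x k.*2); field.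
- rewrite big_ord_recr/= doubleS.
  have -> : \prod_(i < k) (i.*2.+1)%:R * (k.*2.+1)%:R * s ^+ k.*2.+2 =
    (k.*2.+1%:R * s ^+ 2) * (\prod_(i < k) (i.*2.+1)%:R * s ^+ k.*2) - s ^+ 2 * 0.
    by rewrite mulr0 subr0 -[in LHS]addn2 (exprD s k.*2); ring.
  apply: cvgB; apply: cvgMr => //; exact: cvg_expr_normal_pdf.
(* The boundary term vanishes at 0 because it carries an odd power of [x]. *)
- rewrite F0 expr0n mul0r mulr0 subr0 big_ord_recr/= doubleS.
  rewrite -[in RHS]addn2 (exprD s k.*2); ring.
Qed.

(** The change of variables involves the Radon-Nikodym derivative of the law; it agrees almost
    everywhere with [normal_pdf], since both have the same integral over every measurable set. *)
Lemma ge0_integral_normal_prob (R : realType) (m s : R)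
    (f : R -> \bar R) :
  measurable_fun [set: R] f -> (forall x, 0 <= f x)%E ->
  (\int[normal_prob m s]_x f x =
   \int[lebesgue_measure]_x (f x * (normal_pdf m s x)%:E))%E.
Proof.
move=> mf f0.
have dom := normal_prob_dominates m s.
rewrite -(Radon_Nikodym_SigmaFinite.change_of_variables dom f0 measurableT mf).
apply: ae_eq_integral => //.
- apply: emeasurable_funM => //.
  exact: (measurable_int _ (Radon_Nikodym_SigmaFinite.f_integrable dom)).
- apply: emeasurable_funM => //; apply/measurable_EFinP.
  exact: measurable_normal_pdf.
- apply: ae_eqe_mul2l; apply: integral_ae_eq => //.
  + exact: Radon_Nikodym_SigmaFinite.f_integrable.
  + by apply/measurable_EFinP; exact: measurable_normal_pdf.
  + by move=> E _ mE; rewrite -Radon_Nikodym_SigmaFinite.f_integral.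
Qed.

(** This brings integrals over the line to [[0, +oo[], where an antiderivative with a limit at
    infinity evaluates them and where the parity of the density can be used. *)
Lemma ge0_integralT_fold (R : realType) (f : R -> R) :
  continuous f -> (forall x, 0 <= f x) ->
  (\int[lebesgue_measure]_x (f x)%:E =
   \int[lebesgue_measure]_(x in `[0%R, +oo[) (f (- x))%:E +
   \int[lebesgue_measure]_(x in `[0%R, +oo[) (f x)%:E)%E.
Proof.
move=> cf f0.
have mf : measurable_fun [set: R] f by exact: continuous_measurable_fun.
have UT : `]-oo, (0 : R)[ `|` `[0, +oo[ = [set: R] by rewrite -setCitvl setUv.
transitivity (\int[lebesgue_measure]_(x in `]-oo, 0%R[ `|` `[0%R, +oo[) (f x)%:E)%E.
  by rewrite UT.
rewrite ge0_integral_setU//=; first last.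
- rewrite disj_set2E; apply/eqP; rewrite -subset0 => x []/=.
  by rewrite !in_itv/= andbT leNgt => ->.
- by move=> x _; rewrite lee_fin.
- by rewrite UT; apply/measurable_EFinP.
congr (_ + _)%E.
(* A single point has measure zero, so the half-line may be closed at 0; writing 0 as [- 0] then
   prepares the reflection [x -> - x]. *)
rewrite integral_itv_bndo_bndc; last exact/measurable_EFinP/measurable_funTS.
rewrite -{1}oppr0 ge0_integration_by_substitutionNy//.
exact: continuous_subspaceT.
Qed.

(* Both halves of the integral equal [c_k (1 - F_0 0)]; the factor
   [2 (1 - F_0 0)] is identified with [1] by taking [k = 0]. *)
Lemma integral_even_pow_normal_pdf (R : realType) (s : R) (k : nat) : 0 < s ->
  (\int[lebesgue_measure]_x (x ^+ k.*2 * normal_pdf 0 s x)%:E =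
   ((\prod_(i < k) (i.*2.+1)%:R) * s ^+ k.*2)%:E)%E.
Proof.
move=> s0; have sN0 : s != 0 by rewrite gt_eqF.
have cX j : continuous (fun x : R => x ^+ j * normal_pdf 0 s x).
  move=> x; apply: cvgM; first exact: exprn_continuous.
  exact: continuous_normal_pdf.
have f0 j (x : R) : 0 <= x ^+ j.*2 * normal_pdf 0 s x.
  by rewrite mulr_ge0 ?normal_pdf_ge0// -mul2n exprM exprn_ge0 ?sqr_ge0.
have half j : (\int[lebesgue_measure]_x (x ^+ j.*2 * normal_pdf 0 s x)%:E =
    (2 * (1 - fine (normal_prob 0 s `]-oo, 0%R])) *
     (\prod_(i < j) (i.*2.+1)%:R * s ^+ j.*2))%:E)%E.
  have [F [/= dF Fl F0]] := normal_moment_primitive _ s j s0.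
  have cF x : {for x, continuous F}.
    by apply: differentiable_continuous; apply/derivable1_diffP; case: (dF x).
  rewrite ge0_integralT_fold//.
  under eq_integral => x _.
    rewrite -mul2n exprM sqrrN -exprM mul2n.
    rewrite normal_pdf_even//.
    over.
  rewrite (@ge0_continuous_FTC2y _ _ F 0 _ _ _ Fl)//.
  - by rewrite F0 -EFinD; congr EFin; ring.
  - exact: continuous_subspaceT.
  - exact/cvg_at_right_filter/cF.
  - by move=> x _; rewrite derive1E; case: (dF x).
rewrite half; congr EFin.
have : 2 * (1 - fine (normal_prob 0 s `]-oo, 0%R])) = 1.
  have := half 0; rewrite big_ord0 expr0 !mulr1.
  under eq_integral do rewrite expr0 mul1r.
  by rewrite integral_normal_pdf => -[].
by move=> ->; rewrite mul1r.
Qed.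

(** * Moments of a normal random variable *)

Section normal_moments.
Context {d : measure_display} {T : measurableType d} {R : realType}.
Variables (P : probability T R) (X : {RV P >-> R}).

(** For nonnegative [f] the identity holds in the extended reals, so it can itself serve to prove
    integrability, as in [integrable_even_pow]. *)
Lemma ge0_integral_normal_law (m s : R) (f : R -> R) :
  has_normal_law X m s -> measurable_fun setT f -> (forall x, 0 <= f x) ->
  (\int[P]_w (f (X w))%:E =
   \int[lebesgue_measure]_x (f x * normal_pdf m s x)%:E)%E.
Proof.
move=> hX mf f0.
have mEf : measurable_fun [set: R] (EFin \o f) by exact/measurable_EFinP.
have Ef0 x : (0 <= (EFin \o f) x)%E by rewrite lee_fin.
(* The canonical measurable structures of [R] and [measurableTypeR R] are not
   convertible, hence the repackaging of [X]. *)
pose Y : {mfun T >-> measurableTypeR R} := HB.pack (X : T -> measurableTypeR R)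
  (isMeasurableFun.Build _ _ T (measurableTypeR R) X (@measurable_funPT _ _ _ _ X)).
have := @ge0_integral_distribution _ _ _ _ _ P Y (EFin \o f) mEf Ef0.
rewrite /comp/= => <-.
transitivity (\int[normal_prob m s]_x (f x)%:E)%E.
  by apply: eq_measure_integral => A mA _; exact: hX.
by rewrite ge0_integral_normal_prob.
Qed.

Variables (s : R) (s0 : 0 < s) (hX : has_normal_law X 0 s).

Lemma integral_even_pow (k : nat) : (\int[P]_w (X w ^+ k.*2)%:E =
  ((\prod_(i < k) (i.*2.+1)%:R) * s ^+ k.*2)%:E)%E.
Proof.
rewrite (ge0_integral_normal_law 0 s (fun x => x ^+ k.*2))//.
- exact: integral_even_pow_normal_pdf.
- by move=> x; rewrite -mul2n exprM exprn_ge0 ?sqr_ge0.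
Qed.

Lemma integrable_even_pow (k : nat) :
  P.-integrable setT (fun w => (X w ^+ k.*2)%:E).
Proof.
apply/integrableP; split.
  by apply/measurable_EFinP; apply: measurable_funX; exact: measurable_funP.
under eq_integral => w _.
  rewrite /= ger0_norm; last by rewrite -mul2n exprM exprn_ge0 ?sqr_ge0.
  over.
by rewrite /= integral_even_pow ltry.
Qed.

Lemma normal_moment_even (k : nat) :
  moment X k.*2 = (\prod_(i < k) (i.*2.+1)%:R) * s ^+ k.*2.
Proof. by rewrite /moment unlock integral_even_pow. Qed.

(** Folding the integrals of the positive and the negative part at 0 produces the same two half-line
    integrals in opposite order, because the density is even. *)
Lemma normal_moment1 : moment X 1 = 0.
Proof.
rewrite /moment unlock integralE.
have -> : (\int[P]_w ((fun w => (X w ^+ 1)%:E)^\+ w) =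
           \int[P]_w (Num.max (X w) 0)%:E)%E.
  by apply: eq_integral => w _; rewrite funeposE expr1 EFin_max.
have -> : (\int[P]_w ((fun w => (X w ^+ 1)%:E)^\- w) =
           \int[P]_w (Num.max (- X w) 0)%:E)%E.
  by apply: eq_integral => w _; rewrite funenegE expr1 EFin_max.
rewrite (ge0_integral_normal_law 0 s (fun x => Num.max x 0))//; first last.
- by move=> x; rewrite le_max lexx orbT.
- exact: measurable_maxr.
rewrite (ge0_integral_normal_law 0 s (fun x => Num.max (- x) 0))//; first last.
- by move=> x; rewrite le_max lexx orbT.
- by apply: measurable_maxr => //; exact: oppr_measurable.
have cpos : continuous (fun x : R => Num.max x 0 * normal_pdf 0 s x).
  move=> x; apply: cvgM; last by apply: continuous_normal_pdf; rewrite gt_eqF.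
  by apply: continuous_max; [exact: cvg_id|exact: cvg_cst].
have cneg : continuous (fun x : R => Num.max (- x) 0 * normal_pdf 0 s x).
  move=> x; apply: cvgM; last by apply: continuous_normal_pdf; rewrite gt_eqF.
  by apply: continuous_max; [exact: opp_continuous|exact: cvg_cst].
have evenp x : normal_pdf 0 s (- x) = normal_pdf 0 s x.
  by rewrite normal_pdf_even ?gt_eqF.
rewrite !ge0_integralT_fold//; last 2 first.
- by move=> x; rewrite mulr_ge0 ?normal_pdf_ge0// le_max lexx orbT.
- by move=> x; rewrite mulr_ge0 ?normal_pdf_ge0// le_max lexx orbT.
under [X in (_ - (X + _))%E]eq_integral do rewrite opprK evenp.
under [X in (X + _ - _)%E]eq_integral do rewrite evenp.
rewrite [X in (_ - X)%E]addeC.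
(* This covers infinite [v] as well: the difference is then infinite, and [fine] sends it to 0. *)
have fineB0 (v : \bar R) : fine (v - v)%E = 0.
  by case: v => [r| |]//=; rewrite subrr.
exact: fineB0.
Qed.

(** Both [mu_22] and [mu_222] are expectations of polynomials of degree at most three in [X ^ 2];
    this form serves the two, with [a = 0] for the former. *)
Lemma expectation_cubic_pow2 (a b c e : R) :
  fine 'E_P[fun w => a * X w ^+ 6 + b * X w ^+ 4 + c * X w ^+ 2 + e] =
  a * moment X 6 + b * moment X 4 + c * moment X 2 + e.
Proof.
have int2 k r : P.-integrable setT (fun w => (r * X w ^+ k.*2)%:E).
  under eq_fun do rewrite EFinM.
  by apply: integrableZl => //; exact: integrable_even_pow.
have E2 k r : (\int[P]_w (r * X w ^+ k.*2)%:E = (r * moment X k.*2)%:E)%E.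
  under eq_integral do rewrite EFinM.
  rewrite integralZl//; last exact: integrable_even_pow.
  by rewrite normal_moment_even integral_even_pow.
have inte : P.-integrable setT (fun=> e%:E) by exact: finite_measure_integrable_cst.
have i64 : P.-integrable setT (fun w => (a * X w ^+ 6 + b * X w ^+ 4)%:E).
  by under eq_fun do rewrite EFinD; apply: integrableD => //;
    [exact: (int2 3)|exact: (int2 2)].
have i642 : P.-integrable setT
    (fun w => (a * X w ^+ 6 + b * X w ^+ 4 + c * X w ^+ 2)%:E).
  by under eq_fun do rewrite EFinD; apply: integrableD => //; exact: (int2 1).
have Ee : (\int[P]_w e%:E = e%:E)%E.
  by have := expectation_cst P e; rewrite unlock.
rewrite unlock.
under eq_integral do rewrite EFinD.
rewrite integralD//.
under eq_integral do rewrite EFinD.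
rewrite integralD//; last exact: (int2 1).
under eq_integral do rewrite EFinD.
rewrite integralD//; [|exact: (int2 3)|exact: (int2 2)].
by rewrite (E2 3) (E2 2) (E2 1) Ee.
Qed.

Lemma normal_cmoment22 : cmoment X [:: 2; 2] = 2 * s ^+ 4.
Proof.
have m2 := normal_moment_even 1; have m4 := normal_moment_even 2.
rewrite /cmoment.
have -> : (fun w => \prod_(i <- [:: 2; 2]) (X w ^+ i - moment X i)) =
  (fun w => 0 * X w ^+ 6 + 1 * X w ^+ 4
     + (- 2 * moment X 2) * X w ^+ 2 + moment X 2 ^+ 2).
  by apply/funext => w; rewrite !big_cons big_nil; ring.
rewrite expectation_cubic_pow2 m4 m2.
by rewrite !big_ord_recr big_ord0 /double/=; ring.
Qed.

Lemma normal_cmoment222 : cmoment X [:: 2; 2; 2] = 8 * s ^+ 6.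
Proof.
have m2 := normal_moment_even 1; have m4 := normal_moment_even 2.
have m6 := normal_moment_even 3.
rewrite /cmoment.
have -> : (fun w => \prod_(i <- [:: 2; 2; 2]) (X w ^+ i - moment X i)) =
  (fun w => 1 * X w ^+ 6 + (- 3 * moment X 2) * X w ^+ 4
     + (3 * moment X 2 ^+ 2) * X w ^+ 2 + - moment X 2 ^+ 3).
  by apply/funext => w; rewrite !big_cons big_nil; ring.
rewrite expectation_cubic_pow2 m6 m4 m2.
by rewrite !big_ord_recr big_ord0 /double/=; ring.
Qed.

End normal_moments.

(** * Partial derivatives *)

(** The two difference quotients are the same function of the increment, so their limits are
    equal. *)
Lemma partial1_row2 (R : realType) (f : R -> R -> R) (x y : R) :
  partial 1 (fun v : 'rV[R]_2 => f (crd v 1) (crd v 2)) (row2 x y) =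
  'D_1 (fun t => f t y) x.
Proof.
have i0 : inord 0 = 0 :> 'I_2 by apply: val_inj; rewrite /= inordK.
have i1 : inord 1 = 1 :> 'I_2 by apply: val_inj; rewrite /= inordK.
rewrite /partial /derive /crd /row2 /=.
congr (fun q : R -> R => lim (q h @[h --> 0^'])).
by apply/funext => h /=; rewrite i0 i1 !mxE/= mulr0 add0r.
Qed.

Lemma partial2_row2 (R : realType) (f : R -> R -> R) (x y : R) :
  partial 2 (fun v : 'rV[R]_2 => f (crd v 1) (crd v 2)) (row2 x y) =
  'D_1 (f x) y.
Proof.
have i0 : inord 0 = 0 :> 'I_2 by apply: val_inj; rewrite /= inordK.
have i1 : inord 1 = 1 :> 'I_2 by apply: val_inj; rewrite /= inordK.
rewrite /partial /derive /crd /row2 /=.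
congr (fun q : R -> R => lim (q h @[h --> 0^'])).
by apply/funext => h /=; rewrite i0 i1 !mxE/= mulr0 add0r.
Qed.

(** Restriction to a line makes the partial derivative a one-variable derivative, to which
    [derive_quot_zero] applies. *)
Lemma partial_lineE (R : realType) (d k : nat) (f : 'rV[R]_d.+1 -> R)
    (x : 'rV[R]_d.+1) :
  partial k f x = 'D_1 (fun t : R => f (t *: delta_mx 0 (inord k.-1) + x)) 0.
Proof.
rewrite /partial /derive; congr (fun q : R -> R => lim (q h @[h --> 0^'])).
by apply/funext => h /=; rewrite scale0r add0r addr0 [h *: 1]mulr1.
Qed.

(** Out of range, [inord] falls back to index 0; the bounds ensure that different [j] and [k] name
    different coordinates. *)
Lemma crd_line (R : realType) (d j k : nat) (x : 'rV[R]_d.+1) (t : R) :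
  (0 < j <= d.+1)%N -> (0 < k <= d.+1)%N ->
  crd (t *: delta_mx 0 (inord k.-1) + x) j = t * (j == k)%:R + crd x j.
Proof.
case: j => // j; case: k => // k /= jd kd; rewrite /crd !mxE/= eqSS.
by rewrite -val_eqE/= !inordK.
Qed.

(* At a zero of the numerator only the continuity of the denominator matters. *)
Lemma derive_quot_zero (R : realType) (N D : R -> R) (l : R) (x : R) :
  is_derive x 1 N l -> N x = 0 -> {for x, continuous D} -> D x != 0 ->
  'D_1 (fun t => N t / D t) x = l / D x.
Proof.
move=> [dN <-] N0 cD D0; apply: cvg_lim => //.
rewrite (_ : (fun h : R => _) =
  fun h : R => (h^-1 *: ((N \o shift x) (h *: 1) - N x)) * (D (h *: 1 + x))^-1).
  apply: cvgM; first exact: dN.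
  apply: cvgV => //.
  have h0 : h *: 1 + x @[h --> 0^'] --> 0 *: (1 : R^o) + x.
    apply: cvg_within_filter; apply: cvgD; last exact: cvg_cst.
    by apply: cvgZr_tmp; exact: cvg_id.
  rewrite scale0r add0r in h0.
  by apply: (cvg_comp _ _ h0); exact: cD.
by apply/funext => h /=; rewrite N0 mul0r !subr0 /GRing.scale/= mulrA.
Qed.

(* [du l] stands for a partial derivative of [(l - x) / sqrt (y - x ^ 2)]. *)
Definition dg_ML {R : realType} (du : R -> R) (lam x y : R) : R :=
  normal_pdf 0 1 ((lam - x) / Num.sqrt (y - x ^+ 2)) * du lam -
  normal_pdf 0 1 ((- lam - x) / Num.sqrt (y - x ^+ 2)) * du (- lam).

Definition dg_ML1 {R : realType} (lam x y : R) : R :=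
  dg_ML (fun l => ((l - x) * x / (y - x ^+ 2) - 1) / Num.sqrt (y - x ^+ 2)) lam x y.

Definition dg_ML2 {R : realType} (lam x y : R) : R :=
  dg_ML (fun l => - ((l - x) / (2 * (y - x ^+ 2) * Num.sqrt (y - x ^+ 2)))) lam x y.

(** * Derivatives of [g_ML] in each variable *)

Lemma is_derive_Phi_comp (R : realType) (u : R -> R) (x du : R) :
  is_derive x 1 u du ->
  is_derive x 1 (fun t => Phi (u t)) (normal_pdf 0 1 (u x) * du).
Proof.
move=> dudx.
exact: (@is_derive1_comp _ Phi u x _ _ (is_derive_Phi _ _) dudx).
Qed.

Lemma is_derive_standardize (R : realType) (a b : R -> R) (x da db : R) :
  0 < b x -> is_derive x 1 a da -> is_derive x 1 b db ->
  is_derive x 1 (fun t => a t / Num.sqrt (b t))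
    ((da - a x * db / (2 * b x)) / Num.sqrt (b x)).
Proof.
move=> b0 ha hb.
have s0 : Num.sqrt (b x) != 0 by rewrite gt_eqF// sqrtr_gt0.
have hs := @is_derive1_comp _ Num.sqrt b x _ _ (is_derive1_sqrt b0) hb.
have hV := @is_deriveV _ (Num.sqrt \o b) x _ 1 s0 hs.
have := @is_deriveM _ _ a (fun t => (Num.sqrt (b t))^-1) x 1 _ _ ha hV.
move=> H; apply: (is_derive_eq H); rewrite /GRing.scale/=.
(* Once [b x] is written as the square of its root, the identity is rational in [Num.sqrt (b x)] and
   [field] decides it. *)
have -> : 2 * b x = 2 * Num.sqrt (b x) ^+ 2 by rewrite sqr_sqrtr// ltW.
by field.
Qed.

Lemma is_derive_g_ML1 (R : realType) (lam x y : R) : x ^+ 2 < y ->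
  is_derive x 1 (fun t => g_ML lam t y) (dg_ML1 lam x y).
Proof.
rewrite -subr_gt0 => xy.
have H l : is_derive x 1 (fun t => Phi ((l - t) / Num.sqrt (y - t ^+ 2)))
  (normal_pdf 0 1 ((l - x) / Num.sqrt (y - x ^+ 2)) *
   (((l - x) * x / (y - x ^+ 2) - 1) / Num.sqrt (y - x ^+ 2))).
  apply: is_derive_Phi_comp.
  have ha : is_derive x 1 (fun t : R => l - t) (-1).
    by apply: is_derive_eq; rewrite /GRing.scale/=; ring.
  have hb : is_derive x 1 (fun t : R => y - t ^+ 2) (- (2 * x)).
    by apply: is_derive_eq; rewrite /GRing.scale/=; ring.
  apply: (is_derive_eq (is_derive_standardize _ (fun t : R => l - t)
    (fun t : R => y - t ^+ 2) _ _ _ xy ha hb)).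
  by congr (_ / _); field; rewrite gt_eqF.
exact: is_deriveB.
Qed.

Lemma is_derive_g_ML2 (R : realType) (lam x y : R) : x ^+ 2 < y ->
  is_derive y 1 (g_ML lam x) (dg_ML2 lam x y).
Proof.
rewrite -subr_gt0 => xy.
have H l : is_derive y 1 (fun t => Phi ((l - x) / Num.sqrt (t - x ^+ 2)))
  (normal_pdf 0 1 ((l - x) / Num.sqrt (y - x ^+ 2)) *
   - ((l - x) / (2 * (y - x ^+ 2) * Num.sqrt (y - x ^+ 2)))).
  apply: is_derive_Phi_comp.
  have ha : is_derive y 1 (fun t : R => l - x) 0 by exact: is_derive_cst.
  have hb : is_derive y 1 (fun t : R => t - x ^+ 2) 1.
    by apply: is_derive_eq; rewrite /GRing.scale/=; ring.
  apply: (is_derive_eq (is_derive_standardize _ (fun t : R => l - x)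
    (fun t : R => t - x ^+ 2) _ _ _ xy ha hb)).
  by rewrite sub0r mulr1 mulNr [in RHS]invfM mulrA.
exact: is_deriveB.
Qed.

(** * Continuity of the gradient of [g_ML] and of [h_ML] *)

Section cvg_ML.
Context {T : Type} {F : set_system T} {FF : Filter F} {R : realType}.
Variables (lam : R) (u v : T -> R) (x y : R).
Hypotheses (xy : x ^+ 2 < y) (ux : u t @[t --> F] --> x) (vy : v t @[t --> F] --> y).

Let cvg_var : v t - u t ^+ 2 @[t --> F] --> y - x ^+ 2.
Proof.
by apply: cvgB => //; rewrite !expr2; under eq_fun do rewrite expr2; exact: cvgM.
Qed.

Let sd_neq0 : Num.sqrt (y - x ^+ 2) != 0.
Proof. by rewrite gt_eqF// sqrtr_gt0 subr_gt0. Qed.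

Let cvg_sd : Num.sqrt (v t - u t ^+ 2) @[t --> F] --> Num.sqrt (y - x ^+ 2).
Proof. exact: cvg_comp cvg_var (@sqrt_continuous _ _). Qed.

Let cvg_pdf (l : R) :
  normal_pdf 0 1 ((l - u t) / Num.sqrt (v t - u t ^+ 2)) @[t --> F] -->
  normal_pdf 0 1 ((l - x) / Num.sqrt (y - x ^+ 2)).
Proof.
apply: (cvg_comp _ (normal_pdf 0 1)); last first.
  by apply: continuous_normal_pdf; rewrite oner_neq0.
apply: cvgM; first by apply: cvgB => //; exact: cvg_cst.
exact: cvgV.
Qed.

Lemma cvg_dg_ML1 : dg_ML1 lam (u t) (v t) @[t --> F] --> dg_ML1 lam x y.
Proof.
have H l : ((l - u t) * u t / (v t - u t ^+ 2) - 1) / Num.sqrt (v t - u t ^+ 2)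
    @[t --> F] --> ((l - x) * x / (y - x ^+ 2) - 1) / Num.sqrt (y - x ^+ 2).
  apply: cvgM; last exact: cvgV.
  apply: cvgB; last exact: cvg_cst.
  apply: cvgM; last by apply: cvgV; rewrite ?gt_eqF ?subr_gt0.
  by apply: cvgM => //; apply: cvgB => //; exact: cvg_cst.
by apply: cvgB; apply: cvgM; [exact: cvg_pdf|exact: H|exact: cvg_pdf|exact: H].
Qed.

Lemma cvg_dg_ML2 : dg_ML2 lam (u t) (v t) @[t --> F] --> dg_ML2 lam x y.
Proof.
have H l : - ((l - u t) / (2 * (v t - u t ^+ 2) * Num.sqrt (v t - u t ^+ 2)))
    @[t --> F] --> - ((l - x) / (2 * (y - x ^+ 2) * Num.sqrt (y - x ^+ 2))).
  apply: cvgN; apply: cvgM; first by apply: cvgB => //; exact: cvg_cst.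
  apply: cvgV; first by rewrite !mulf_neq0 ?pnatr_eq0// gt_eqF ?subr_gt0.
  by apply: cvgM => //; exact: cvgMr.
by apply: cvgB; apply: cvgM; [exact: cvg_pdf|exact: H|exact: cvg_pdf|exact: H].
Qed.

(** The domain [x ^ 2 < y] is open, so the closed forms of the partial derivatives are eventually
    valid along the filter. *)
Lemma near_var_gt0 : \forall t \near F, u t ^+ 2 < v t.
Proof.
have := @cvgr_gt _ _ _ _ _ _ cvg_var 0; rewrite subr_gt0 => /(_ FF xy).
by apply: filterS => t; rewrite subr_gt0.
Qed.

End cvg_ML.

Lemma partial_g_ML1 (R : realType) (lam x y : R) : x ^+ 2 < y ->
  partial_g_ML lam 1 x y = dg_ML1 lam x y.
Proof.
by move=> xy; rewrite /partial_g_ML partial1_row2; case: (is_derive_g_ML1 _ lam x y xy).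
Qed.

Lemma partial_g_ML2 (R : realType) (lam x y : R) : x ^+ 2 < y ->
  partial_g_ML lam 2 x y = dg_ML2 lam x y.
Proof.
by move=> xy; rewrite /partial_g_ML partial2_row2; case: (is_derive_g_ML2 _ lam x y xy).
Qed.

Lemma sum_1_3 (V : nmodType) (f : nat -> V) : \sum_(1 <= i < 3) f i = f 1 + f 2.
Proof. by rewrite big_ltn// big_ltn// big_geq// addr0. Qed.

Lemma h_MLE (R : realType) (lam : R) (x : 'rV[R]_4) : crd x 1 ^+ 2 < crd x 2 ->
  h_ML lam x = Num.sqrt
    (dg_ML1 lam (crd x 1) (crd x 2) ^+ 2 * (crd x 2 - crd x 1 ^+ 2) +
     dg_ML1 lam (crd x 1) (crd x 2) * dg_ML2 lam (crd x 1) (crd x 2) *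
       (crd x 3 - crd x 1 * crd x 2) *+ 2 +
     dg_ML2 lam (crd x 1) (crd x 2) ^+ 2 * (crd x 4 - crd x 2 ^+ 2)).
Proof.
move=> hx; rewrite /h_ML !sum_1_3 !partial_g_ML1// !partial_g_ML2//.
by congr Num.sqrt; ring.
Qed.

(** Since [h_ML] is defined through derivatives, continuity is proved for the closed form of
    [h_MLE], with which it eventually coincides. *)
Lemma cvg_h_ML (T : Type) (F : set_system T) (FF : Filter F) (R : realType)
    (lam : R) (p : T -> 'rV[R]_4) (x : 'rV[R]_4) :
  crd x 1 ^+ 2 < crd x 2 ->
  (forall k, (0 < k <= 4)%N -> crd (p t) k @[t --> F] --> crd x k) ->
  h_ML lam (p t) @[t --> F] --> h_ML lam x.
Proof.
move=> hx px; rewrite h_MLE//.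
have p1 := px 1 isT; have p2 := px 2 isT; have p3 := px 3 isT; have p4 := px 4 isT.
have E : \forall t \near F, Num.sqrt
    (dg_ML1 lam (crd (p t) 1) (crd (p t) 2) ^+ 2 * (crd (p t) 2 - crd (p t) 1 ^+ 2) +
     dg_ML1 lam (crd (p t) 1) (crd (p t) 2) * dg_ML2 lam (crd (p t) 1) (crd (p t) 2) *
       (crd (p t) 3 - crd (p t) 1 * crd (p t) 2) *+ 2 +
     dg_ML2 lam (crd (p t) 1) (crd (p t) 2) ^+ 2 * (crd (p t) 4 - crd (p t) 2 ^+ 2)) =
    h_ML lam (p t).
  by apply: filterS (near_var_gt0 _ _ _ _ hx p1 p2) => t ht; rewrite h_MLE.
apply: (cvg_trans (near_eq_cvg E)).
have d1 := @cvg_dg_ML1 T F FF R lam _ _ _ _ hx p1 p2.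
have d2 := @cvg_dg_ML2 T F FF R lam _ _ _ _ hx p1 p2.
have sq (f : T -> R) (l : R) : f t @[t --> F] --> l -> f t ^+ 2 @[t --> F] --> l ^+ 2.
  by move=> fl; rewrite expr2; under eq_fun do rewrite expr2; exact: cvgM.
apply: (cvg_comp _ Num.sqrt); last exact: sqrt_continuous.
apply: cvgD; [apply: cvgD|].
- by apply: cvgM; [exact: sq|apply: cvgB => //; exact: sq].
- apply: cvgMn; apply: cvgM; first exact: cvgM.
  by apply: cvgB => //; exact: cvgM.
- by apply: cvgM; [exact: sq|apply: cvgB => //; exact: sq].
Qed.

(** * The coefficients *)

(** At [x = 0] the inner derivative no longer depends on the end point, and the even density gives
    both end points the same weight, so the two terms cancel. *)
Lemma dg_ML1_center (R : realType) (lam y : R) : dg_ML1 lam 0 y = 0.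
Proof.
rewrite /dg_ML1 /dg_ML !subr0 !mulr0 !mul0r mulNr normal_pdf_even ?oner_neq0//.
by rewrite subrr.
Qed.

(** Here the inner derivative is odd in the end point: the two terms add up and absorb the factor 2
    of the denominator. *)
Lemma dg_ML2_center (R : realType) (lam y : R) :
  dg_ML2 lam 0 y = - (normal_pdf 0 1 (lam / Num.sqrt y) * (lam / (y * Num.sqrt y))).
Proof.
rewrite /dg_ML2 /dg_ML !subr0 expr0n/= subr0 mulNr normal_pdf_even ?oner_neq0//.
rewrite -mulrA invfM; lra.
Qed.

Lemma crd_mean_vec (d : measure_display) (T : measurableType d) (R : realType)
    (P : probability T R) (X : {RV P >-> R}) (k : nat) : (0 < k <= 4)%N ->
  crd (mean_vec X) k = moment X k.
Proof. by case: k => // k /= k4; rewrite /crd mxE inordK. Qed.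

Section gradient.
Context {d : measure_display} {T : measurableType d} {R : realType}.
Variables (P : probability T R) (X : {RV P >-> R}) (lam sigma : R).
Hypotheses (hlam : 0 < lam) (hsigma : 0 < sigma) (hX : has_normal_law X 0 sigma).

Let mu1 : crd (mean_vec X) 1 = 0.
Proof. by rewrite crd_mean_vec// (normal_moment1 _ _ _ hsigma hX). Qed.

Let mu2 : crd (mean_vec X) 2 = sigma ^+ 2.
Proof.
rewrite crd_mean_vec// (normal_moment_even _ _ _ hsigma hX 1).
by rewrite big_ord_recr big_ord0/= !mul1r.
Qed.

Let mu4 : crd (mean_vec X) 4 = 3 * sigma ^+ 4.
Proof.
rewrite crd_mean_vec// (normal_moment_even _ _ _ hsigma hX 2).
by rewrite !big_ord_recr big_ord0/= !mul1r.
Qed.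

Let s2_gt0 : (0 : R) ^+ 2 < sigma ^+ 2.
Proof. by rewrite expr0n/= exprn_gt0. Qed.

Let D2 := dg_ML2 lam 0 (sigma ^+ 2).

(** The sign resolves the absolute value in [h_ML_mean], which makes [a_2] negative, and ensures
    that [h_ML] does not vanish at the mean vector. *)
Let D2_lt0 : D2 < 0.
Proof.
rewrite /D2 dg_ML2_center oppr_lt0 sqrtr_sqr gtr0_norm//.
rewrite mulr_gt0 ?divr_gt0 ?mulr_gt0 ?exprn_gt0//.
rewrite normal_pdfE ?oner_neq0// mulr_gt0 ?expR_gt0//.
by rewrite normal_peak_gt0 ?oner_neq0.
Qed.

Lemma h_ML_mean : h_ML lam (mean_vec X) =
  - dg_ML2 lam 0 (sigma ^+ 2) * sigma ^+ 2 * Num.sqrt 2.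
Proof.
rewrite h_MLE ?mu1 ?mu2 ?mu4// dg_ML1_center -/D2.
(* The third moment stays symbolic: its coefficient contains the vanishing first partial
   derivative. *)
have -> : 0 ^+ 2 * (sigma ^+ 2 - 0 ^+ 2) +
   0 * D2 * (crd (mean_vec X) 3 - 0 * sigma ^+ 2) *+ 2 +
   D2 ^+ 2 * (3 * sigma ^+ 4 - (sigma ^+ 2) ^+ 2) = (- D2 * sigma ^+ 2) ^+ 2 * 2.
  by ring.
rewrite sqrtrM ?sqr_ge0// sqrtr_sqr ger0_norm//.
by rewrite mulr_ge0 ?sqr_ge0// oppr_ge0 ltW.
Qed.

Let h_neq0 : h_ML lam (mean_vec X) != 0.
Proof.
rewrite h_ML_mean -/D2 gt_eqF// mulr_gt0 ?sqrtr_gt0// mulr_gt0 ?exprn_gt0//.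
by rewrite oppr_gt0.
Qed.

Let line (k : nat) (t : R) : 'rV[R]_4 := t *: delta_mx 0 (inord k.-1) + mean_vec X.

(** On the line through the mean vector in direction [k], the numerator of [A_MLs] vanishes at
    [t = 0], so [derive_quot_zero] leaves only its derivative [l] over the value of [h_ML]. *)
Lemma coef_a_quot (k : nat) (l : R) : (0 < k <= 4)%N ->
  is_derive (0 : R) 1 (fun t : R =>
    g_ML lam (t * (1 == k)%N%:R) (t * (2 == k)%N%:R + sigma ^+ 2)) l ->
  coef_a X lam sigma k = l / h_ML lam (mean_vec X).
Proof.
move=> k4 dl; rewrite /coef_a partial_lineE.
have lineE (j : nat) (t : R) : (0 < j <= 4)%N ->
    crd (line k t) j = t * (j == k)%:R + crd (mean_vec X) j.
  by move=> j4; rewrite crd_line.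
pose N (t : R) := g_ML lam (t * (1 == k)%N%:R) (t * (2 == k)%N%:R + sigma ^+ 2) -
  g_ML lam 0 (sigma ^+ 2).
have -> : (fun t : R => A_MLs lam sigma (t *: delta_mx 0 (inord k.-1) + mean_vec X)) =
    (fun t => N t / h_ML lam (line k t)).
  apply/funext => t; rewrite -[t *: _ + _]/(line k t) /A_MLs.
  rewrite (lineE 1 t isT) (lineE 2 t isT) mu1 mu2 addr0.
  reflexivity.
have line0 : line k 0 = mean_vec X by rewrite /line scale0r add0r.
rewrite -[X in _ = _ / h_ML lam X]line0.
apply: derive_quot_zero.
- apply: (is_derive_eq (is_deriveB dl (is_derive_cst _ _ _))).
  by rewrite subr0.
- by rewrite /N !mul0r add0r subrr.
- apply: cvg_h_ML; rewrite line0; first by rewrite mu1 mu2.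
  move=> j j4; under eq_fun do rewrite lineE//.
  have H : t * (j == k)%:R + crd (mean_vec X) j @[t --> (0 : R)] -->
      0 * (j == k)%:R + crd (mean_vec X) j.
    by apply: cvgD; [apply: cvgMl; exact: cvg_id|exact: cvg_cst].
  by rewrite mul0r add0r in H.
- by rewrite line0.
Qed.

Lemma coef_a1 : coef_a X lam sigma 1 = 0.
Proof.
rewrite -[RHS](mul0r (h_ML lam (mean_vec X))^-1); apply: coef_a_quot => //.
rewrite -[X in is_derive _ _ _ X](dg_ML1_center _ lam (sigma ^+ 2)).
have -> : (fun t : R =>
    g_ML lam (t * (1 == 1)%N%:R) (t * (2 == 1)%N%:R + sigma ^+ 2)) =
  fun t => g_ML lam t (sigma ^+ 2).
  by apply/funext => t; rewrite /= mulr1 mulr0 add0r.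
exact: is_derive_g_ML1.
Qed.

Lemma coef_a2 : coef_a X lam sigma 2 = - (sigma ^+ 2 * Num.sqrt 2)^-1.
Proof.
transitivity (D2 / h_ML lam (mean_vec X)); last first.
  have D20 : D2 != 0 by rewrite lt_eqF.
  by rewrite h_ML_mean -/D2 -mulrA invfM invrN mulrA mulrN divff// mulN1r.
apply: coef_a_quot => //.
have -> : (fun t : R =>
    g_ML lam (t * (1 == 2)%N%:R) (t * (2 == 2)%N%:R + sigma ^+ 2)) =
  g_ML lam 0 \o (fun t => t + sigma ^+ 2).
  by apply/funext => t; rewrite /= mulr1 mulr0.
rewrite -[X in is_derive _ _ _ X]mulr1; apply: is_derive1_comp.
  by rewrite add0r; exact: is_derive_g_ML2.
by apply: is_derive_eq; rewrite addr0.
Qed.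

(** As [g_ML] sees only the first two coordinates, the numerator is constant along these lines, even
    though [h_ML] may vary. *)
Lemma coef_a_ge3 (k : nat) : (3 <= k <= 4)%N -> coef_a X lam sigma k = 0.
Proof.
move=> /andP[k3 k4]; rewrite -[RHS](mul0r (h_ML lam (mean_vec X))^-1).
apply: coef_a_quot; first by rewrite k4 (leq_trans _ k3).
have k1 : (1 == k)%N = false by apply: ltn_eqF; exact: leq_trans k3.
have k2 : (2 == k)%N = false by exact: ltn_eqF.
have -> : (fun t : R =>
    g_ML lam (t * (1 == k)%N%:R) (t * (2 == k)%N%:R + sigma ^+ 2)) =
  cst (g_ML lam 0 (sigma ^+ 2)).
  by apply/funext => t; rewrite k1 k2 !mulr0 add0r.
exact: is_derive_cst.
Qed.

End gradient.

(** * The constants [A], [tau] and [a] *)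

Lemma sum_1_5 (V : nmodType) (f : nat -> V) :
  \sum_(1 <= i < 5) f i = f 1 + f 2 + f 3 + f 4.
Proof. by do 4 rewrite big_ltn//; rewrite big_geq// addr0 !addrA. Qed.

Lemma BCa_AE (d : measure_display) (T : measurableType d) (R : realType)
    (P : probability T R) (X : {RV P >-> R}) (lam sigma : R) :
  coef_a X lam sigma 1 = 0 ->
  (forall k, (3 <= k <= 4)%N -> coef_a X lam sigma k = 0) ->
  BCa_A X lam sigma = coef_a X lam sigma 2 ^+ 3 * cmoment X [:: 2; 2; 2].
Proof.
move=> a1 a34; rewrite /BCa_A !sum_1_5 a1 (a34 3 isT) (a34 4 isT).
by rewrite !(mulr0, mul0r, add0r, addr0); ring.
Qed.

Lemma BCa_tauE (d : measure_display) (T : measurableType d) (R : realType)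
    (P : probability T R) (X : {RV P >-> R}) (lam sigma : R) :
  coef_a X lam sigma 1 = 0 ->
  (forall k, (3 <= k <= 4)%N -> coef_a X lam sigma k = 0) ->
  BCa_tau X lam sigma = Num.sqrt (coef_a X lam sigma 2 ^+ 2 * cmoment X [:: 2; 2]).
Proof.
move=> a1 a34; rewrite /BCa_tau !sum_1_5 a1 (a34 3 isT) (a34 4 isT).
by rewrite !(mulr0, mul0r, add0r, addr0).
Qed.

Theorem proposition5p4 (R : realType) (lam sigma : R)
    (hlam : 0 < lam) (hsigma : 0 < sigma)
    (d : measure_display) (T : measurableType d) (P : probability T R)
    (X : {RV P >-> R}) (hX : has_normal_law X 0 sigma)
    (n : nat) (hn : (0 < n)%N) :
  (forall x : 'I_n -> R, sample_moment x 1 ^+ 2 < sample_moment x 2 ->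
     forall p : R, is_interval_MLE lam x p <->
       p = g_ML lam (sample_moment x 1) (sample_moment x 2)) /\
  BCa_A X lam sigma = - (2 * Num.sqrt 2) /\
  BCa_acceleration X lam sigma n = - (Num.sqrt 2 / (3 * Num.sqrt n%:R)).
Proof.
have a1 := coef_a1 _ _ _ _ hlam hsigma hX.
have a2 := coef_a2 _ _ _ _ hlam hsigma hX.
have a34 := coef_a_ge3 _ _ _ _ hlam hsigma hX.
have sN0 : sigma != 0 by rewrite gt_eqF.
pose r : R := Num.sqrt 2.
have rN0 : r != 0 by rewrite gt_eqF// sqrtr_gt0.
have r2 : r ^+ 2 = 2 by rewrite sqr_sqrtr.
have AE : BCa_A X lam sigma = - (2 * r).
  rewrite BCa_AE// a2 (normal_cmoment222 _ _ _ hsigma hX) -/r.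
  have -> : (- (sigma ^+ 2 * r)^-1) ^+ 3 * (8 * sigma ^+ 6) = - (8 / (r ^+ 2 * r)).
    by field; rewrite rN0 sN0.
  (* What remains is [8 / (2 * r) = 2 * r]; putting the difference over [r] reduces it to
     [r ^ 2 = 2]. *)
  rewrite r2; apply/eqP; rewrite eqr_opp eq_sym -subr_eq0.
  have -> : 2 * r - 8 / (2 * r) = (2 * r ^+ 2 - 4) / r by field.
  by rewrite r2 (_ : 2 * 2 - 4 = 0) ?mul0r//; ring.
(* Division by [h_ML] normalizes the asymptotic variance: [tau ^ 2] becomes [2 / r ^ 2 = 1]. *)
have tauE : BCa_tau X lam sigma = 1.
  rewrite BCa_tauE// a2 (normal_cmoment22 _ _ _ hsigma hX) -/r.
  have -> : (- (sigma ^+ 2 * r)^-1) ^+ 2 * (2 * sigma ^+ 4) = 2 / r ^+ 2.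
    by field; rewrite rN0 sN0.
  by rewrite r2 divff ?pnatr_eq0// sqrtr1.
split=> [x mx p|]; first exact: interval_MLE_iff.
split=> //.
rewrite /BCa_acceleration AE tauE -/r expr1n mulr1.
by field; rewrite gt_eqF// sqrtr_gt0 ltr0n.
Qed.
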